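(* Let $r\ge 3$, $t\ge 1$, and let $\mathcal{K}_n^r(t)$ be the complete $r$-uniform $n$-partite hypergraph with parts $V_1,\dots,V_n$, where $|V_i|=t$ for $1\le i\le n$. If $n>2(r-1)^2$, then $\chi^{e}(\mathcal{K}_n^r(t))=2$.
   Context: A hypergraph $\mathcal{H}=(V,E)$ has a finite nonempty vertex set $V$ and a collection $E$ of distinct nonempty subsets of $V$ (edges); it is $r$-uniform if every edge has size $r$. The complete $r$-uniform $n$-partite hypergraph $\mathcal{K}_n^r(t)$ has vertex set $V_1\cup\dots\cup V_n$ (disjoint parts of size $t$) and as edges all $r$-subsets containing at most one vertex from each part. For an edge weighting $w:E(\mathcal{H})\to\{1,\dots,k\}$ put $\sigma^{e}(v)=\sum_{e\ni v}w(e)$. A vertex coloring of a hypergraph is proper if every edge contains two vertices of distinct colors. $\chi^{e}(\mathcal{H})$ is the minimum $k$ such that some $w:E(\mathcal{H})\to\{1,\dots,k\}$ makes $\sigma^{e}$ a proper vertex coloring. *)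

(* Defs.v *)
From mathcomp Require Import all_boot.

Set Implicit Arguments.
Unset Strict Implicit.
Unset Printing Implicit Defensive.

Record hypergraph := Hypergraph {
  vertex :> finType;
  edges : {set {set vertex}};
  vertex_nonempty : 0 < #|vertex|;
  edges_nonempty : set0 \notin edges
}.

Definition uniform (H : hypergraph) (r : nat) : Prop :=
  forall e : {set H}, e \in edges H -> #|e| = r.

(* H is a copy of K_n^r(t) whose parts are the sets V i. *)
Record complete_multipartite (H : hypergraph) (r n t : nat)
    (V : 'I_n -> {set H}) : Prop := CompleteMultipartite {
  parts_disjoint : forall i j : 'I_n, i != j -> [disjoint V i & V j];
  parts_cover : \bigcup_(i < n) V i = [set: H];
  parts_card : forall i : 'I_n, #|V i| = t;
  parts_edges : forall e : {set H},
    e \in edges H <-> #|e| = r /\ forall i : 'I_n, #|e :&: V i| <= 1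
}.

(* Only the values of w on the edges of H matter, here and below. *)
Definition edge_weighting (H : hypergraph) (k : nat) (w : {set H} -> nat)
  : Prop := forall e : {set H}, e \in edges H -> 1 <= w e <= k.

Definition sigma_e (H : hypergraph) (w : {set H} -> nat) (v : H) : nat :=
  \sum_(e in edges H | v \in e) w e.

Definition proper_coloring (H : hypergraph) (C : Type) (c : H -> C) : Prop :=
  forall e : {set H}, e \in edges H ->
    exists x y : H, [/\ x \in e, y \in e & c x <> c y].

Definition sigma_e_colorable (H : hypergraph) (k : nat) : Prop :=
  exists w : {set H} -> nat, edge_weighting k w /\ proper_coloring (sigma_e w).

(* chi^e(H) = k.  This is a relation because some hypergraphs (such as those
   with an edge of size 1) admit no suitable weighting for any k. *)
Definition is_chi_e (H : hypergraph) (k : nat) : Prop :=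
  sigma_e_colorable H k /\ forall j : nat, sigma_e_colorable H j -> k <= j.

Lemma complete_multipartite_uniform (H : hypergraph) (r n t : nat)
    (V : 'I_n -> {set H}) : complete_multipartite r t V -> uniform H r.
Proof. by case=> _ _ _ edgesP e /edgesP[]. Qed.

Lemma complete_multipartite_exists (r n t : nat) :
  0 < r -> 0 < n -> 0 < t ->
  exists (H : hypergraph) (V : 'I_n -> {set H}), complete_multipartite r t V.
Proof.
move=> r0 n0 t0.
pose T : finType := ('I_n * 'I_t)%type.
pose V (i : 'I_n) : {set T} := [set x | x.1 == i].
pose E : {set {set T}} :=
  [set e : {set T} | (#|e| == r) && [forall i, #|e :&: V i| <= 1]].
have T0 : 0 < #|T| by rewrite card_prod !card_ord muln_gt0 n0.
have E0 : set0 \notin E by rewrite inE cards0 eq_sym -leqn0 leqNgt r0.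
exists (Hypergraph T0 E0), V; split=> /=.
- move=> i j neq_ij; rewrite -setI_eq0; apply/eqP/setP=> x; rewrite !inE.
  by apply/negP=> /andP[/eqP-> /eqP eq_ij]; rewrite eq_ij eqxx in neq_ij.
- by apply/setP=> x; rewrite !inE; apply/bigcupP; exists x.1; rewrite ?inE.
- move=> i; have -> : V i = setX [set i] [set: 'I_t].
    by apply/setP=> -[a b]; rewrite !inE andbT.
  by rewrite cardsX cards1 cardsT card_ord mul1n.
- move=> e; rewrite inE; split=> [/andP[/eqP-> /forallP]|[-> He]] //.
  by rewrite eqxx; apply/forallP.
Qed.

(* Main.v *)
(* An edge has weight 2 when the levels of its parts add up to at least a
   threshold m, and weight 1 otherwise, where the r - 1 consecutive parts with
   index k such that k / (r - 1) = a have level a, and m is the top level.  An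
   edge meets r parts, hence at least two levels, so it suffices that sigma
   strictly increases with the level.  If x lies below y, take a permutation of
   the vertices that sends x to y and exchanges their parts: it maps the edges
   at x onto those at y and never decreases their level sums.  An edge through
   x whose other parts avoid that of y and have level sum m - 1 - level(x)
   gains weight.  The same permutation shows that a constant weighting has a
   constant sigma. *)
Require Import Defs.
From mathcomp Require Import all_boot all_fingroup zify.

Set Implicit Arguments.
Unset Strict Implicit.
Unset Printing Implicit Defensive.

(* The part of a vertex as a function, instead of a family of sets. *)
Definition part_map (H : hypergraph) (r t n : nat) (p : H -> 'I_n) : Prop :=
  (forall i, #|[set v | p v == i]| = t) /\
  (forall e : {set H}, e \in edges H <-> #|e| = r /\ {in e &, injective p}).

Lemma part_map_exists (H : hypergraph) (r t n : nat) (V : 'I_n -> {set H}) :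
  complete_multipartite r t V -> exists p : H -> 'I_n, part_map r t p.
Proof.
case=> disjV covV cardV edgesV.
have memV v : exists i, v \in V i.
  have: v \in [set: H] by [].
  by rewrite -covV => /bigcupP[i _ vi]; exists i.
pose p v := xchoose (memV v).
have pV v i : (v \in V i) = (p v == i).
  apply/idP/eqP => [vi | <-]; last exact: (xchooseP (memV v)).
  apply: contraTeq vi => /disjV /disjointFr -> //.
  exact: (xchooseP (memV v)).
exists p; split=> [i | e].
  by rewrite -(cardV i); apply: eq_card => v; rewrite inE pV.
rewrite edgesV; split=> -[re pe]; split=> //.
  move=> u v ue ve puv; apply: (card_le1_eqP (pe (p v))).
    by rewrite inE pV ve eqxx.
  by rewrite inE pV ue puv eqxx.
move=> i; apply/card_le1_eqP => u v; rewrite !inE !pV.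
by move=> /andP[ue /eqP pu] /andP[ve /eqP pv]; apply: pe; rewrite // pu pv.
Qed.

(** Since parts have equal size, a vertex can go to the same position in the enumeration of the
    exchanged part. A transposition inside the part of [y] then corrects the image of [x]. *)
Lemma part_swap (H : hypergraph) (r t n : nat) (p : H -> 'I_n) (x y : H) :
  part_map r t p ->
  exists g : {perm H}, g x = y /\ forall v, p (g v) = tperm (p x) (p y) (p v).
Proof.
case=> cardp _.
pose P i := enum [set v | p v == i].
pose s := tperm (p x) (p y).
have sizeP i : size (P i) = t by rewrite -cardE.
have memP v i : (v \in P i) = (p v == i) by rewrite mem_enum inE.
pose q v := index v (P (p v)).
have qt v : q v < t by rewrite -(sizeP (p v)) index_mem memP.
(* The default [x] is never returned: every part has [t] vertices and [q v < t]. *)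
pose f v := nth x (P (s (p v))) (q v).
have pf v : p (f v) = s (p v).
  by apply/eqP; rewrite -memP mem_nth // sizeP.
have qf v : q (f v) = q v by rewrite /q pf index_uniq ?enum_uniq // sizeP.
have f_inj : injective f.
  move=> u v fuv.
  have puv : p u = p v by apply: (@perm_inj _ s); rewrite -!pf fuv.
  have quv : q u = q v by rewrite -(qf u) fuv qf.
  rewrite -(nth_index x (_ : u \in P (p u))) ?memP // -/(q u) quv puv.
  by rewrite nth_index // memP.
exists (perm f_inj * tperm (f x) y)%g; split=> [|v].
  by rewrite permM permE tpermL.
rewrite permM permE -/s -pf; case: tpermP => // ->; rewrite pf /s tpermL //.
Qed.

Lemma edge_of_parts (H : hypergraph) (r t n : nat) (p : H -> 'I_n) (x : H)
    (A : {set 'I_n}) :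
  part_map r t p -> 0 < t -> #|A| = r -> p x \in A ->
  exists e : {set H}, [/\ e \in edges H, x \in e & p @: e = A].
Proof.
case=> cardp edgesp t0 cardA xA.
have rep i : exists v, p v == i.
  have: 0 < #|[set v | p v == i]| by rewrite cardp.
  by case/card_gt0P => v; rewrite inE; exists v.
pose h i := if i == p x then x else xchoose (rep i).
have hK : cancel h p.
  rewrite /h => i; case: eqP => [-> //|_]; exact/eqP/(xchooseP (rep i)).
exists (h @: A); split.
- apply/edgesp; split; first by rewrite card_imset //; apply: can_inj hK.
  by move=> _ _ /imsetP[i _ ->] /imsetP[j _ ->]; rewrite !hK => ->.
- by apply/imsetP; exists (p x) => //; rewrite /h eqxx.
by rewrite -imset_comp (eq_imset (g := id)) ?imset_id.
Qed.

Lemma imset_edge (H : hypergraph) (r t n : nat) (p : H -> 'I_n)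
    (g : {perm H}) (s : {perm 'I_n}) (e : {set H}) :
  part_map r t p -> (forall v, p (g v) = s (p v)) ->
  (g @: e \in edges H) = (e \in edges H).
Proof.
case=> _ edgesp pg; apply/idP/idP => /edgesp[re pe]; apply/edgesp.
  split; first by rewrite -re card_imset //; apply: perm_inj.
  move=> u v ue ve puv; apply: (@perm_inj _ g).
  by apply: pe; rewrite ?imset_f // !pg puv.
split; first by rewrite card_imset //; apply: perm_inj.
move=> _ _ /imsetP[u ue ->] /imsetP[v ve ->]; rewrite !pg => /perm_inj puv.
by rewrite (pe u v).
Qed.

(** Reindexing along [g] lets the sums at [x] and at [g x] be compared term by term over the edges
    at [x]. *)
Lemma sigma_e_perm (H : hypergraph) (r t n : nat) (p : H -> 'I_n)
    (g : {perm H}) (s : {perm 'I_n}) (w : {set H} -> nat) (x : H) :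
  part_map r t p -> (forall v, p (g v) = s (p v)) ->
  sigma_e w (g x) = \sum_(e in edges H | x \in e) w (g @: e).
Proof.
move=> pp pg; rewrite /sigma_e (reindex_inj (imset_inj (@perm_inj _ g))) /=.
apply: eq_bigl => e; rewrite (imset_edge _ pp pg) mem_imset //.
exact: perm_inj.
Qed.

(** If [j] is in [A], the transposition only permutes the terms; otherwise its sole effect is to
    replace [l i] by [l j]. *)
Lemma leq_sum_tperm (n : nat) (l : 'I_n -> nat) (i j : 'I_n)
    (A : {set 'I_n}) :
  i \in A -> l i <= l j ->
  \sum_(k in A) l k <= \sum_(k in A) l (tperm i j k)
    ?= iff (j \in A) || (l i == l j).
Proof.
move=> iA lij; case: (boolP (j \in A)) => jA /=.
  have -> : \sum_(k in A) l k = \sum_(k in A) l (tperm i j k).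
    rewrite (reindex_inj (@perm_inj _ (tperm i j))) /=.
    by apply: eq_bigl => k; case: tpermP => [->|->|]; rewrite ?iA ?jA.
  exact/leqif_refl.
rewrite (bigD1 i) //= [X in _ <= X ?= iff _](bigD1 i) //= tpermL.
rewrite [X in _ <= _ + X ?= iff _](eq_bigr l).
  by split; rewrite ?leq_add2r ?eqn_add2r.
move=> k /andP[kA ki]; rewrite tpermD // 1?eq_sym //.
by apply: contraNneq jA => <-.
Qed.

(* The level of a part is its index divided by [d = r - 1], so that each level
   consists of at most [d] parts, and of exactly [d] except for the top one. *)
Lemma level_set (d n : nat) (i j : 'I_n) :
  1 < d -> 2 * d < n -> i %/ d < j %/ d ->
  exists S : {set 'I_n}, [/\ #|S| = d, i \notin S, j \notin S &
    \sum_(k in S) k %/ d + (i %/ d).+1 = n.-1 %/ d].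
Proof.
move=> d1 dn ij; have d0 : 0 < d by lia.
set m := n.-1 %/ d.
have jm : j %/ d <= m by apply: leq_div2r; have := ltn_ord j; lia.
have m2 : 2 <= m by rewrite /m leq_divRL //; lia.
have nm : m * d <= n.-1 by apply: leq_divM.
pose Z := [set k : 'I_n | k < d].
have cardZ : #|Z| = d.
  have dn' : d <= n by lia.
  have widen_inj : injective (widen_ord dn').
    by move=> k k' /(congr1 val) /= kk'; apply: val_inj.
  rewrite -[RHS]card_ord -cardsT -(card_imset _ widen_inj).
  apply: eq_card => k; rewrite inE; apply/idP/imsetP => [kd | [k' _ ->] //=].
  by exists (Ordinal kd) => //; apply: val_inj.
have levZ k : k \in Z -> k %/ d = 0 by rewrite inE => /divn_small.
have jZ : j \notin Z by apply: contraTN ij => /levZ ->.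
(* When [i] is just below the top level, the other parts must all have level 0, and [Z] supplies
   them. *)
have [i0 | i_lt] := eqVneq (i %/ d).+1 m.
  exists Z; split=> //; last by rewrite big1.
  by apply/negP => /levZ; lia.
have im : (i %/ d).+1 < m by rewrite ltn_neqAle i_lt (leq_trans ij jm).
(* Otherwise one part of level [c] and [d - 1] parts of level 0 make up the sum. *)
set c := m - (i %/ d).+1.
have c0 : 0 < c by rewrite subn_gt0.
have cm : c < m by rewrite ltn_subrL (ltnW m2).
have cdn : c * d + 1 < n by have := leq_mul cm (leqnn d); lia.
(* Level [c] contains the parts [c * d] and [c * d + 1]; as [i] and [j] have different levels, they
   cannot occupy both. *)
have [x [xc xi xj]] : exists x : 'I_n, [/\ x %/ d = c, x != i & x != j].
  have cd : c * d < n by lia.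
  pose x0 := Ordinal cd; pose x1 := Ordinal cdn.
  have lx0 : x0 %/ d = c by rewrite /= mulnK.
  have lx1 : x1 %/ d = c by rewrite /= divnMDl // divn_small ?addn0.
  have x01 : x1 != x0 by rewrite -val_eqE /=; lia.
  have [x0i | x0i] := eqVneq x0 i.
    exists x1; rewrite lx1 -x0i x01; split=> //.
    by apply: contraTneq ij => <-; rewrite -x0i lx0 lx1 ltnn.
  have [x0j | x0j] := eqVneq x0 j; last by exists x0.
  exists x1; rewrite lx1 -x0j x01; split=> //.
  by apply: contraTneq ij => <-; rewrite -x0j lx0 lx1 ltnn.
have : d.-1 <= #|Z :\ i|.
  by have := cardsD1 i Z; rewrite cardZ; case: (i \in Z); lia.
case/card_geqP => s [us ss sZ].
have xs : x \notin s.
  by apply/negP => /sZ /setD1P[_ /levZ]; lia.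
exists [set k in x :: s]; split.
- by rewrite cardsE (card_uniqP _) /= ?xs //= ss; lia.
- rewrite !inE negb_or eq_sym xi /=; apply/negP => /sZ; by rewrite !inE eqxx.
- rewrite !inE negb_or eq_sym xj /=; apply/negP => /sZ /setD1P[_].
  exact/negP.
rewrite (eq_bigl (mem (x :: s))); last by move=> k; rewrite inE.
rewrite -big_uniq /= ?xs // big_cons xc big1_seq ?addn0.
  by rewrite /c; lia.
by move=> k /andP[_ /sZ /setD1P[_ /levZ]].
Qed.

Theorem theorem3p1 (r t n : nat) (H : hypergraph) (V : 'I_n -> {set H}) :
  3 <= r -> 1 <= t ->
  complete_multipartite r t V ->
  2 * (r - 1) ^ 2 < n ->
  is_chi_e H 2.
Proof.
move=> r3 t1 /part_map_exists[p pp] nr.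
set d := r - 1 in nr.
have d1 : 1 < d by lia.
have dn : 2 * d < n by nia.
pose l (k : 'I_n) := k %/ d.
split; last first.
  move=> j [w [wj w_proper]]; rewrite leqNgt; apply/negP => j1.
  have w1 e : e \in edges H -> w e = 1 by move=> /wj; lia.
  have /card_gt0P[x _] := vertex_nonempty H.
  (* The colouring being constant is contradictory only once an edge exists; [r] parts including
     that of [x] give one. *)
  have [A [cardA xA]] : exists A : {set 'I_n}, #|A| = r /\ p x \in A.
    have : r.-1 <= #|[set~ p x]| by rewrite cardsC1 card_ord; lia.
    case/card_geqP => s [us ss sx]; exists [set k in p x :: s].
    rewrite !inE eqxx cardsE (card_uniqP _) /= ?ss ?us ?andbT; first by lia.
    by apply/negP => /sx; rewrite !inE eqxx.
  have [e [eE _ _]] := edge_of_parts pp t1 cardA xA.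
  have [y [z [_ _]]] := w_proper e eE; apply.
  have [g [<- pg]] := part_swap y z pp.
  rewrite (sigma_e_perm _ _ pp pg); apply: eq_bigr => e' /andP[e'E _].
  by rewrite !w1 // (imset_edge _ pp pg).
pose L (e : {set H}) := \sum_(k in p @: e) l k.
pose w (e : {set H}) := if n.-1 %/ d <= L e then 2 else 1.
exists w; split=> [e _ | e eE]; first by rewrite /w; case: ifP.
have [re pe] : #|e| = r /\ {in e &, injective p} by apply/(proj2 pp).
suff lt_sigma x y : l (p x) < l (p y) -> sigma_e w x < sigma_e w y.
  have [[x [y [xe ye lxy]]]|] :
      (exists x y, [/\ x \in e, y \in e & l (p x) <> l (p y)]) \/
      {in e &, forall x y, l (p x) = l (p y)}.
    have [|] := boolP [exists x in e, exists y in e, l (p x) != l (p y)].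
      move=> /exists_inP[x xe] /exists_inP[y ye] /eqP lxy.
      by left; exists x, y.
    rewrite negb_exists_in => /forall_inP le; right=> x y xe ye.
    have := le x xe; rewrite negb_exists_in => /forall_inP/(_ y ye).
    by move=> /negPn/eqP.
  exists x, y; split=> //.
    by case: (ltngtP (l (p x)) (l (p y))) => // /lt_sigma; lia.
  move=> le; exfalso.
  (* Parts of equal level are told apart by their residues mod [d], but [e] meets [r = d + 1]
     parts. *)
  pose f v : 'I_d := Ordinal (ltn_pmod (p v) (ltnW d1)).
  have f_inj : {in e &, injective f}.
    move=> x y xe ye /(congr1 val) /= fxy; apply: pe => //; apply: val_inj.
    by rewrite /= (divn_eq (p x) d) (divn_eq (p y) d) fxy -!/(l _) (le x y).
  have := max_card (mem (f @: e)).
  by rewrite card_in_imset // card_ord re; lia.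
move=> lxy; have [g [gx pg]] := part_swap x y pp.
have Lg (e' : {set H}) :
    L (g @: e') = \sum_(k in p @: e') l (tperm (p x) (p y) k).
  rewrite /L -imset_comp (eq_imset (g := tperm (p x) (p y) \o p));
    last exact: pg.
  by rewrite imset_comp big_imset //= => k k' _ _; apply: perm_inj.
rewrite -gx (sigma_e_perm _ _ pp pg).
have le_L (e' : {set H}) : x \in e' -> L e' <= L (g @: e').
  move=> xe'; rewrite Lg; apply/leq_of_leqif/leq_sum_tperm; last exact: ltnW.
  exact: imset_f.
have [S [cardS xS yS sumS]] := level_set d1 dn lxy.
have cardA : #|p x |: S| = r by rewrite cardsU1 xS cardS; lia.
have [e0 [e0E xe0 pe0]] := edge_of_parts pp t1 cardA (setU11 _ _).
have Le0 : L e0 = l (p x) + \sum_(k in S) l k by rewrite /L pe0 big_setU1.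
(* Equality is excluded: [p y] is not among the parts of [e0], and the two levels differ. *)
have lt_L : L e0 < L (g @: e0).
  have lyx : l (p x) != l (p y) by rewrite neq_ltn lxy.
  rewrite Lg (ltn_leqif (leq_sum_tperm (imset_f _ xe0) (ltnW lxy))) pe0.
  rewrite !inE (negPf yS) orbF negb_or lyx andbT.
  by apply: contraNneq lyx => ->.
(* The sum [L e0] is one below the threshold, so [e0] has weight 1 and its image weight 2; no other
   term decreases. *)
rewrite /sigma_e (bigD1 e0) ?e0E //= [X in _ < X](bigD1 e0) ?e0E //=.
rewrite -addSn leq_add //.
  rewrite /l in Le0; rewrite /w ifN ?ifT -?ltnNge //; lia.
apply: leq_sum => e' /andP[/andP[_ xe'] _]; rewrite /w.
by have := le_L e' xe'; case: ifP; case: ifP => //; lia.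
Qed.
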